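(* Let $q>0$ and let $L:C(\mathbb{T})\to C(\mathbb{T})$ be the transfer operator with $d=2$ and weight $f(t)=|\cos(\pi t)|^q$, that is, $$(Lu)(t)=\frac12\sum_{i=0}^{1}\left|\cos\left(\pi\frac{t+i}{2}\right)\right|^qu\left(\frac{t+i}{2}\right).$$ Let $r=\lim_{n\to\infty}\left(\min_{t\in\mathbb{T}}(L^n1)(t)\right)^{1/n}$ and $R=\lim_{n\to\infty}\left(\max_{t\in\mathbb{T}}(L^n1)(t)\right)^{1/n}$. Then $$r=\frac12\quad\text{for all }q>0,$$ and $$R=\begin{cases}2^{-q}&\text{if }0<q\le1,\\ \frac12&\text{if }q>1.\end{cases}$$
   Context: $\mathbb{T}=\mathbb{R}/\mathbb{Z}$ is identified with $[0,1]$ with $0$ and $1$ identified. $C(\mathbb{T})$ is the Banach space of continuous complex-valued functions on $\mathbb{T}$ with the maximum norm. The limits defining $r$ and $R$ exist, and $R$ equals the spectral radius of $L$. *)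

(* Defs.v *)
From mathcomp Require Import all_boot all_order all_algebra.
From mathcomp Require Import complex.
From mathcomp Require Import all_classical all_reals all_analysis.

Set Implicit Arguments.
Unset Strict Implicit.
Unset Printing Implicit Defensive.

Import Order.TTheory GRing.Theory Num.Theory.
Import numFieldNormedType.Exports.

Local Open Scope classical_set_scope.
Local Open Scope complex_scope.
Local Open Scope ring_scope.

(* [R[i]] itself carries no topology instance; typing it as an abstract
   [numClosedFieldType] gives it the one induced by the modulus. *)
Definition cplx (R : realType) : numClosedFieldType := R[i].

Definition toC (R : realType) (x : R) : cplx R := x%:C.

(* Continuous functions on [R / Z] are encoded as continuous 1-periodic
   functions on the line. *)
Record circle_fun (R : realType) (K : topologicalType) := CircleFun {
  circle_val :> R -> K;
  circle_cont : continuous circle_val;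
  circle_per : forall t, circle_val (t + 1) = circle_val t }.

Section CircleFunctions.
Variable R : realType.

Lemma continuous_toC : continuous (@toC R).
Proof.
move=> x; apply/cvgrPdist_lt => e e0.
have [eI e0'] : (e : R[i]) = (complex.Re e)%:C /\ 0 < complex.Re e.
  case: e e0 => a b; rewrite ltcE /= => /andP[/eqP b0 a0]; split => //.
  by rewrite b0.
have : \forall y \near x, `|x - y| < complex.Re e.
  exact: (@cvgr_dist_lt _ _ _ _ _ id x (@cvg_id R (nbhs x)) _ e0').
apply: filterS => y h.
rewrite /toC -[X in `|X|]raddfB.
have -> : `|(x - y)%:C| = (`|x - y|)%:C :> R[i].
  by rewrite normc_def /= expr0n /= addr0 sqrtr_sqr.
by rewrite eI ltcR.
Qed.

Definition circle_one : circle_fun R (cplx R) :=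
  @CircleFun R (cplx R) (fun=> 1) (@cst_continuous R (cplx R) 1) (fun=> erefl).

Section Transfer.
Variables (d : nat) (f : circle_fun R R).

Definition transfer_fun (u : R -> cplx R) (t : R) : cplx R :=
  d%:R^-1 * \sum_(i < d) toC (f ((t + i%:R) / d%:R)) * u ((t + i%:R) / d%:R).

Lemma transfer_cont (u : circle_fun R (cplx R)) : continuous (transfer_fun u).
Proof.
have ci (i : nat) : continuous (fun t : R => (t + i%:R) / d%:R).
  by move=> t; apply: cvgMl; apply: cvgD; [exact: cvg_id|exact: cvg_cst].
rewrite /transfer_fun => t; apply: cvgM; first exact: cvg_cst.
apply: (cvg_big (@add_continuous (cplx R))) => i _; apply: cvgM; last first.
  exact: (continuous_comp (@ci i t) (@circle_cont _ _ u _)).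
apply: (@continuous_comp _ _ _ (fun t : R => f ((t + i%:R) / d%:R)) (@toC R)).
  exact: (continuous_comp (@ci i t) (@circle_cont _ _ f _)).
exact: continuous_toC.
Qed.

Lemma transfer_per (u : circle_fun R (cplx R)) t :
  transfer_fun u (t + 1) = transfer_fun u t.
Proof.
rewrite /transfer_fun; congr (_ * _); case: d => [|e]; first by rewrite !big_ord0.
rewrite big_ord_recr big_ord_recl /= addrC; congr (_ + _).
  rewrite addr0 -addrA nat1r mulrDl divff ?pnatr_eq0//.
  by rewrite !circle_per.
apply: eq_bigr => i _; rewrite -addrA.
by have -> : 1 + i%:R = (bump 0 i)%:R :> R by rewrite /bump /= natrD.
Qed.

Definition transfer (u : circle_fun R (cplx R)) : circle_fun R (cplx R) :=
  CircleFun (@transfer_cont u) (@transfer_per u).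

End Transfer.

Section CosWeight.
Variables (q : R) (q0 : 0 < q).

Lemma continuous_abs_powR : continuous (fun x : R => `|x| `^ q).
Proof.
move=> x; have [->|x0] := eqVneq x 0.
  apply/cvgrPdist_lt => e e0; rewrite normr0 powR0 ?gt_eqF//.
  have d0 : 0 < e `^ q^-1 by rewrite powR_gt0.
  have : \forall y \near (0 : R), `|0 - y| < e `^ q^-1.
    exact: (@cvgr_dist_lt _ _ _ _ _ id 0 (@cvg_id R (nbhs 0)) _ d0).
  apply: filterS => y; rewrite !sub0r !normrN => h.
  rewrite ger0_norm ?powR_ge0//.
  have -> : e = (e `^ q^-1) `^ q by rewrite -powRrM mulVf ?gt_eqF// powRr1// ltW.
  by rewrite gt0_ltr_powR// nnegrE ?powR_ge0.
apply: (@continuous_comp R R R (fun x : R => `|x|) (fun y : R => y `^ q)).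
  exact: norm_continuous.
apply: differentiable_continuous; apply/derivable1_diffP.
by apply: derivable_powR; rewrite in_itv/= andbT normr_gt0.
Qed.

Definition cos_weight_fun (t : R) : R := `|cos (pi * t)| `^ q.

Lemma cos_weight_cont : continuous cos_weight_fun.
Proof.
move=> t; apply: (@continuous_comp _ _ _ (fun t => cos (pi * t))
  (fun x : R => `|x| `^ q)); last exact: continuous_abs_powR.
apply: (@continuous_comp _ _ _ (fun t : R => pi * t) (@cos R)).
  by apply: cvgMr; exact: cvg_id.
exact: continuous_cos.
Qed.

Lemma cos_weight_per t : cos_weight_fun (t + 1) = cos_weight_fun t.
Proof. by rewrite /cos_weight_fun mulrDr mulr1 cosDpi normrN. Qed.

Definition cos_weight : circle_fun R R := CircleFun cos_weight_cont cos_weight_per.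

Lemma transfer_cosE (u : circle_fun R (cplx R)) t :
  transfer 2 cos_weight u t =
  2^-1 * \sum_(i < 2) toC (`|cos (pi * ((t + i%:R) / 2))| `^ q) *
                       u ((t + i%:R) / 2).
Proof. by []. Qed.

End CosWeight.

(* The order on [cplx R] is [z <= w] iff [Im z = Im w] and [Re z <= Re w], so
   these relations can only hold for a real-valued [u]. *)
Definition is_circle_min (u : circle_fun R (cplx R)) (m : R) :=
  (exists t, u t = toC m) /\ (forall t, toC m <= u t).

Definition is_circle_max (u : circle_fun R (cplx R)) (m : R) :=
  (exists t, u t = toC m) /\ (forall t, u t <= toC m).

(* The default value 0 is not used on the iterates of a transfer operator at the
   constant 1: see [circle_minP], [circle_maxP], [iter_transfer_one_real]. *)
Definition circle_min (u : circle_fun R (cplx R)) : R :=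
  xget 0 [set m | is_circle_min u m].

Definition circle_max (u : circle_fun R (cplx R)) : R :=
  xget 0 [set m | is_circle_max u m].

Lemma circle_val_itv (K : topologicalType) (u : circle_fun R K) t :
  exists2 s, s \in `[0 : R, 1] & u s = u t.
Proof.
have perN (n : nat) s : u (s + n%:R) = u s.
  elim: n s => [|n IHn] s; first by rewrite addr0.
  by rewrite -natr1 addrA circle_per.
exists (t - (Num.floor t)%:~R).
  have := floor_itv t; rewrite in_itv/= subr_ge0 lerBlDl intrD1.
  by case/andP => -> /ltW.
case: (Num.floor t) => n; first by rewrite -(perN n) subrK.
by rewrite NegzE mulrNz opprK perN.
Qed.

Lemma continuous_Re (u : circle_fun R (cplx R)) :
  continuous (fun t : R => complex.Re (u t)).
Proof.
move=> t; apply/cvgrPdist_lt => e e0.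
have e0' : (0 : cplx R) < toC e by rewrite /toC ltcR.
have : \forall s \near t, `|u t - u s| < toC e.
  exact: (@cvgr_dist_lt _ _ _ _ _ _ _ (@circle_cont _ _ u t) _ e0').
apply: filterS => s h; rewrite -ltcR.
have -> : complex.Re (u t) - complex.Re (u s) = complex.Re (u t - u s).
  by case: (u t) (u s) => a b [c d].
exact: le_lt_trans (normc_ge_Re _) h.
Qed.

Lemma circle_minP (u : circle_fun R (cplx R)) :
  (forall t, u t \is Num.real) -> is_circle_min u (circle_min u).
Proof.
move=> ur; apply: (@xgetPex _ 0 [set m | is_circle_min u m]).
have [//||c _ cP] := @EVT_min R (fun t => complex.Re (u t)) 0 1.
  by apply: continuous_subspaceT; exact: continuous_Re.
exists (complex.Re (u c)); split; first by exists c; rewrite /toC RRe_real.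
move=> t; have [s sI <-] := circle_val_itv u t.
by rewrite -(RRe_real (ur s)) lecR cP.
Qed.

Lemma circle_maxP (u : circle_fun R (cplx R)) :
  (forall t, u t \is Num.real) -> is_circle_max u (circle_max u).
Proof.
move=> ur; apply: (@xgetPex _ 0 [set m | is_circle_max u m]).
have [//||c _ cP] := @EVT_max R (fun t => complex.Re (u t)) 0 1.
  by apply: continuous_subspaceT; exact: continuous_Re.
exists (complex.Re (u c)); split; first by exists c; rewrite /toC RRe_real.
move=> t; have [s sI <-] := circle_val_itv u t.
by rewrite -(RRe_real (ur s)) lecR cP.
Qed.

Lemma iter_transfer_one_real d (f : circle_fun R R) n t :
  iter n (transfer d f) circle_one t \is Num.real.
Proof.
elim: n t => [|n IH] t /=; first exact: real1.
apply: rpredM; first by rewrite rpredV realn.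
apply: rpred_sum => i _; apply: rpredM; last exact: IH.
by apply/complex_realP; eexists.
Qed.

End CircleFunctions.

(* Main.v *)
Require Import Defs.
From mathcomp Require Import all_boot all_order all_algebra.
From mathcomp Require Import all_classical all_reals all_analysis.
From mathcomp Require Import complex ring lra.

Import Order.TTheory GRing.Theory Num.Theory.
Import numFieldNormedType.Exports.

Local Open Scope classical_set_scope.
Local Open Scope ring_scope.

(* Let w(t) = |sin(pi t)|, c = |cos(pi t/2)|, s = |sin(pi t/2)|, so that w takes
   the values s and c at the two preimages of t and w(t) = 2cs.
   - L(w^q) = 2^-q w^q, and (L^n 1)(0) = 2^-n: lower bounds for the maximum and
     an upper bound for the minimum.
   - For q = 1, c + s <= 1 + cs gives L 1 <= 1/2 + w/4, hence
     L^n 1 <= 2^-n (1 + n w/2).  For q >= 1 the weight only decreases, and for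
     q <= 1 concavity of x^q bounds L^n 1 by the q-th power of the case q = 1.
   - g = 1 - (2/3) w^2 lies between 1/3 and 1 and satisfies L(g^q) >= g^q / 2,
     by keeping the larger branch only; hence L^n 1 >= 3^-q 2^-n.
   All bounds match up to a factor between a positive constant and n + 1, which
   n-th roots remove. *)

(** * Limits of n-th roots and concavity of powers *)

(** After a shift: ln(n+2) = 2 ln sqrt(n+2) <= 2 sqrt(n+2) <= 4 sqrt(n+1), so the quotient is at
    most 4 / sqrt(n+1). *)
Lemma cvg_ln_div (R : realType) : ln n.+1%:R / n%:R @[n --> \oo] --> (0 : R).
Proof.
rewrite -cvg_shiftS /=.
have h0 : 4 * Num.sqrt (harmonic n) @[n --> \oo] --> (0 : R).
  rewrite -[X in _ --> X](mulr0 4); apply: cvgM; first exact: cvg_cst.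
  rewrite -[X in _ --> X]sqrtr0.
  exact: (cvg_comp _ _ cvg_harmonic (@sqrt_continuous R 0)).
apply: squeeze_cvgr (@cvg_cst _ (0 : R) _ _ _) h0.
near=> n; apply/andP; split.
  by rewrite mulr_ge0 ?invr_ge0 ?ler0n// ln_ge0// ler1n.
have n0 : 0 < n.+1%:R :> R by rewrite ltr0n.
set s := Num.sqrt (n.+1%:R : R).
have s0 : 0 < s by rewrite sqrtr_gt0.
have ss : s ^+ 2 = n.+1%:R by rewrite sqr_sqrtr// ltW.
rewrite /harmonic sqrtrV ?(ltW n0)// -/s.
rewrite -ss ler_pdivrMr ?exprn_gt0// expr2 mulrA mulfVK ?gt_eqF//.
have -> : n.+2%:R = Num.sqrt n.+2%:R ^+ 2 :> R by rewrite sqr_sqrtr// ler0n.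
rewrite lnXn ?sqrtr_gt0 ?ltr0n//.
have : Num.sqrt n.+2%:R <= 2 * s :> R.
  rewrite -(@ler_pXn2r _ 2)// ?nnegrE ?sqrtr_ge0 ?mulr_ge0 ?(ltW s0)//.
  rewrite exprMn ss sqr_sqrtr ?ler0n// -natrX -natrM ler_nat.
  by rewrite -[n.+2]addn1 (mulSn 3) leq_add2l muln_gt0.
have : ln (Num.sqrt n.+2%:R) <= Num.sqrt n.+2%:R :> R.
  by apply/ltW/ln_sublinear; rewrite sqrtr_gt0 ltr0n.
lra.
Unshelve. all: by end_near. Qed.

(** After taking logarithms, ln(m n) / n is squeezed between ln(c)/n + ln(rho) and ln(n+1)/n +
    ln(rho). *)
Lemma cvg_root_geometric (R : realType) (m : nat -> R) (c rho : R) :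
  0 < c -> 0 < rho ->
  (forall n, c * rho ^+ n <= m n <= n.+1%:R * rho ^+ n) ->
  m n `^ n%:R^-1 @[n --> \oo] --> rho.
Proof.
move=> c0 r0 cm.
have m0 n : 0 < m n.
  by case/andP: (cm n) => + _; apply: lt_le_trans; rewrite mulr_gt0 ?exprn_gt0.
have nV : n%:R^-1 @[n --> \oo] --> (0 : R).
  by rewrite -cvg_shiftS; exact: cvg_harmonic.
rewrite -[X in _ --> X]lnK// [X in X @ _ --> _](_ : _ =
    (fun n : nat => expR (n%:R^-1 * ln (m n)))); last first.
  by apply/funext => n; rewrite /powR gt_eqF.
suff mid : n%:R^-1 * ln (m n) @[n --> \oo] --> ln rho.
  exact: (cvg_comp _ _ mid (@continuous_expR R (ln rho))).
have lo : ln c / n%:R + ln rho @[n --> \oo] --> ln rho.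
  rewrite -[X in _ --> X]add0r; apply: cvgD; last exact: cvg_cst.
  by rewrite -[X in _ --> X](mulr0 (ln c)); apply: cvgM nV; exact: cvg_cst.
have hi : ln n.+1%:R / n%:R + ln rho @[n --> \oo] --> ln rho.
  rewrite -[X in _ --> X]add0r; apply: cvgD; last exact: cvg_cst.
  exact: cvg_ln_div.
apply: squeeze_cvgr lo hi; near=> n.
have n0 : 0 < n%:R :> R by rewrite ltr0n; near: n; exists 1%N.
have lnM k : 0 < k -> ln k / n%:R + ln rho = n%:R^-1 * ln (k * rho ^+ n).
  move=> k0; rewrite lnM ?posrE ?exprn_gt0// lnXn// mulrDr -[ln rho *+ n]mulr_natl.
  by rewrite mulKf ?gt_eqF// mulrC.
by rewrite !lnM// ?ltr0n// !ler_pM2l ?invr_gt0// !ler_ln ?posrE ?mulr_gt0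
  ?exprn_gt0.
Unshelve. all: by end_near. Qed.

(** Convexity of x^(1/p) at the points a^p and b^p with weight 1/2, then both sides raised to the
    power p. *)
Lemma powR_midpoint_concave (R : realType) (p a b : R) :
  0 < p <= 1 -> 0 <= a -> 0 <= b ->
  (a `^ p + b `^ p) / 2 <= ((a + b) / 2) `^ p.
Proof.
move=> /andP[p0 p1] a0 b0.
have q1 : 1 <= p^-1 by rewrite invf_ge1.
have pK x : 0 <= x -> (x `^ p) `^ p^-1 = x.
  by move=> x0; rewrite -powRrM mulfV ?gt_eqF// powRr1.
have Kp x : 0 <= x -> (x `^ p^-1) `^ p = x.
  by move=> x0; rewrite -powRrM mulVf ?gt_eqF// powRr1.
have h0 : 0 <= (a `^ p + b `^ p) / 2 by rewrite divr_ge0// addr_ge0 ?powR_ge0.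
rewrite -[leLHS]Kp//; apply: ge0_ler_powR; first exact: ltW.
- by rewrite nnegrE powR_ge0.
- by rewrite nnegrE divr_ge0// addr_ge0.
have h1 : (2^-1 : R) <= 1 by rewrite invf_le1 ?ler1n.
have h2 : (0 : R) <= 2^-1 by [].
have := @convex_powR R _ q1 (Itv01 h2 h1) (a `^ p) (b `^ p).
rewrite !inE/= !in_itv/= !powR_ge0 => /(_ erefl erefl).
rewrite convRE [X in X `^ _ <= _]convRE /= !pK// -[unstable.onem _]/(1 - 2^-1).
have -> : 1 - 2^-1 = 2^-1 :> R by lra.
by rewrite -!mulrDr ![2^-1 * _]mulrC.
Qed.

(** * The transfer operator on real functions *)

(** Since cos(x + pi/2) = - sin x, the weight of the second branch is a power of |sin(pi t/2)|. *)
Definition cos_transfer {R : realType} (q : R) (u : R -> R) (t : R) : R :=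
  (`|cos (pi * (t / 2))| `^ q * u (t / 2) +
   `|sin (pi * (t / 2))| `^ q * u ((t + 1) / 2)) / 2.

Section CosTransfer.
Context {R : realType} {q : R} (q0 : 0 < q).
Implicit Types (u v : R -> R) (t : R).

Local Notation T := (@cos_transfer R q).
Local Notation T1 n := (iter n T (fun=> 1)).
Local Notation w t := `|sin (pi * t)|.

(** Abstracting the half-angle values turns the later estimates into polynomial inequalities on c^2
    + s^2 = 1. *)
Let cs t : exists c s : R,
  [/\ `|cos (pi * (t / 2))| = c, `|sin (pi * (t / 2))| = s, 0 <= c & 0 <= s] /\
  [/\ c ^+ 2 + s ^+ 2 = 1, w ((t + 1) / 2) = c & w t = 2 * c * s].
Proof.
exists `|cos (pi * (t / 2))|, `|sin (pi * (t / 2))|; split; split => //.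
- by rewrite !real_normK ?num_real// cos2Dsin2.
- by rewrite [(t + 1) / 2]mulrDl mulrDr mul1r sinDpihalf.
- have -> : pi * t = (pi * (t / 2)) *+ 2 by rewrite -mulr_natr -mulrA divfK.
  by rewrite sin_mulr2n -mulr_natl !normrM normr_nat mulrA.
Qed.

Let powR_le1 (x : R) : 0 <= x -> x <= 1 -> x `^ q <= 1.
Proof.
move=> x0 x1; have -> : 1 = 1 `^ q :> R by rewrite powR1.
by apply: ge0_ler_powR; rewrite ?nnegrE// ltW.
Qed.

Lemma cos_transfer_le u v t : (forall s, u s <= v s) -> T u t <= T v t.
Proof. by move=> uv; rewrite ler_pM2r// lerD// ler_wpM2l// powR_ge0. Qed.

Lemma cos_transferZ k u t : T (fun s => k * u s) t = k * T u t.
Proof. by rewrite /cos_transfer; ring. Qed.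

Lemma iter_cos_transfer_le (v : nat -> R -> R) : (forall t, 1 <= v 0%N t) ->
  (forall n t, T (v n) t <= v n.+1 t) -> forall n t, T1 n t <= v n t.
Proof.
move=> v0 vS; elim=> [//|n IH] t; apply: le_trans (vS n t).
exact: cos_transfer_le.
Qed.

(** By positivity of the operator, L^n 1 >= L^n u >= rho^n u. *)
Lemma iter_cos_transfer_ge (rho : R) u : (forall t, u t <= 1) -> 0 <= rho ->
  (forall t, rho * u t <= T u t) -> forall n t, rho ^+ n * u t <= T1 n t.
Proof.
move=> u1 r0 uT; elim=> [|n IH] t /=; first by rewrite expr0 mul1r.
apply: le_trans (@cos_transfer_le _ _ t IH).
by rewrite cos_transferZ exprSr -mulrA ler_wpM2l ?exprn_ge0.
Qed.

(** * The value at 0 and the lower bounds *)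

(** The preimages of 0 are 0 and 1/2, and the weight vanishes at 1/2. *)
Lemma iter_cos_transfer0 n : T1 n 0 = 2^-1 ^+ n.
Proof.
elim: n => [|n IH] /=; first by rewrite expr0.
rewrite {1}/cos_transfer mul0r mulr0 cos0 sin0 normr1 normr0 powR1.
by rewrite powR0 ?gt_eqF// IH mul0r addr0 mul1r exprS mulrC.
Qed.

Lemma iter_cos_transfer_half_ge n : (2 `^ (- q)) ^+ n <= T1 n 2^-1.
Proof.
suff h t : (2 `^ (- q)) ^+ n * w t `^ q <= T1 n t.
  by have := h 2^-1; rewrite sin_pihalf normr1 powR1 mulr1.
apply: (@iter_cos_transfer_ge (2 `^ (- q)) (fun t => w t `^ q)).
- by move=> s; rewrite powR_le1// sin_max.
- exact: powR_ge0.
move=> s; rewrite /cos_transfer.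
have [c [d [[-> -> c0 d0] [_ -> ->]]]] := cs s.
rewrite !powRM ?mulr_ge0// powRN -mulrA mulKf ?gt_eqF ?powR_gt0//.
by rewrite le_eqVlt; apply/orP; left; apply/eqP; field.
Qed.

Lemma iter_cos_transfer_lower n t : 3^-1 `^ q * 2^-1 ^+ n <= T1 n t.
Proof.
pose g s : R := 1 - 2 / 3 * w s ^+ 2.
have w1 (s : R) : w s ^+ 2 <= 1 by rewrite expr_le1// sin_max.
have w0 (s : R) : 0 <= w s ^+ 2 by rewrite exprn_ge0.
have g3 s : 3^-1 <= g s by rewrite /g; have := w1 s; lra.
have g0 s : 0 <= g s by apply: le_trans (g3 s); rewrite invr_ge0.
have gT s : 2^-1 * g s `^ q <= T (fun r => g r `^ q) s.
  rewrite /cos_transfer mulrC ler_pM2r// -!powRM//.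
  (* One branch suffices: the other contributes a nonnegative term. *)
  have : g s <= `|cos (pi * (s / 2))| * g (s / 2) \/
         g s <= `|sin (pi * (s / 2))| * g ((s + 1) / 2).
    rewrite /g; have [c [d [[-> -> c0 d0] [cd -> ->]]]] := cs s.
    have c1 : c <= 1 by nra.
    have d1 : d <= 1 by nra.
    pose P (x y : R) :=
      1 - 2 / 3 * (2 * x * y) ^+ 2 <= x * (1 - 2 / 3 * y ^+ 2).
    have key x y : 0 <= x -> 0 <= y -> x ^+ 2 + y ^+ 2 = 1 -> y <= x -> P x y.
      move=> x0 y0 xy yx; have x1 : x <= 1 by nra.
      have y2 : 0 <= 1 - 2 * y ^+ 2 by nra.
      (* On x^2 + y^2 = 1 the coefficient 2/3 makes the remainder y^2 (2 x^2 - 1) = y^2 (1 - 2 y^2),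
         which is nonnegative for y <= x. *)
      have -> : P x y = (0 <= x * (1 - x) * (1 - 2 / 3 * y ^+ 2) +
                           y ^+ 2 * (1 - 2 * y ^+ 2)).
        rewrite /P -subr_ge0; congr (0 <= _).
        apply/eqP; rewrite -subr_eq0; apply/eqP.
        transitivity ((x ^+ 2 + y ^+ 2 - 1) * (1 + 2 * y ^+ 2)); first by field.
        by rewrite xy subrr mul0r.
      rewrite addr_ge0// mulr_ge0// ?exprn_ge0// ?mulr_ge0// ?subr_ge0//.
      by nra.
    have [le|/ltW le] := leP d c; [left|right]; first exact: key.
    by rewrite (mulrAC 2 c d); apply: key; rewrite // addrC.
  case=> h; [apply: ler_wpDr|apply: ler_wpDl]; rewrite ?powR_ge0//;
    by apply: ge0_ler_powR; rewrite ?nnegrE ?mulr_ge0 ?g0// ltW.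
apply: le_trans (@iter_cos_transfer_ge 2^-1 (fun r => g r `^ q) _ _ gT n t).
- rewrite mulrC ler_wpM2l ?exprn_ge0//.
  by apply: ge0_ler_powR; rewrite ?nnegrE// ltW.
- by move=> s; apply: powR_le1 => //; rewrite /g; have := w0 s; lra.
- by [].
Qed.

(** * Upper bounds *)

Let v n t : R := 2^-1 ^+ n * (1 + n%:R / 2 * w t).

Let v_ge0 n t : 0 <= v n t.
Proof. by rewrite mulr_ge0 ?exprn_ge0// addr_ge0// mulr_ge0. Qed.

Let v_le n t : v n t <= n.+1%:R * 2^-1 ^+ n.
Proof.
rewrite /v [leRHS]mulrC ler_wpM2l ?exprn_ge0// -[n.+1%:R]nat1r lerD2l.
have : w t <= 1 by exact: sin_max.
have : 0 <= n%:R :> R by [].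
nra.
Qed.

(** The right side minus the left is 2^-(n+1) (1 - c)(1 - s). *)
Let v_step n t :
  (`|cos (pi * (t / 2))| * v n (t / 2) +
   `|sin (pi * (t / 2))| * v n ((t + 1) / 2)) / 2 <= v n.+1 t.
Proof.
rewrite /v; have [c [d [[-> -> c0 d0] [cd -> ->]]]] := cs t.
have c1 : c <= 1 by nra.
have d1 : d <= 1 by nra.
rewrite exprS -[n.+1%:R]natr1; set e := _ ^+ n; set N := n%:R.
have e0 : 0 <= e by rewrite exprn_ge0.
suff : 0 <= e * ((1 - c) * (1 - d)) by lra.
by rewrite mulr_ge0// mulr_ge0 ?subr_ge0.
Qed.

(** For x in [0, 1], x^q <= x, so on [v n] the operator is dominated by the one for exponent 1. *)
Lemma iter_cos_transfer_upper_ge1 n t : 1 <= q ->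
  T1 n t <= n.+1%:R * 2^-1 ^+ n.
Proof.
move=> q1; apply: le_trans (v_le n t).
have ge1 x : 0 <= x <= 1 -> x `^ q <= x.
  case/andP; rewrite le_eqVlt => /predU1P[<- _|x0 x1].
    by rewrite powR0 ?gt_eqF.
  by rewrite ge1r_powR ?x0.
apply: iter_cos_transfer_le => {n t} [t|n t].
  by rewrite /v expr0 !mul0r addr0 mul1r.
apply: le_trans (v_step n t); rewrite ler_pM2r// lerD// ler_wpM2r//.
- by rewrite ge1// normr_ge0 cos_max.
- by rewrite ge1// normr_ge0 sin_max.
Qed.

(** Midpoint concavity pulls the average of the q-th powers inside one power, where [v_step]
    applies. *)
Lemma iter_cos_transfer_upper_le1 n t : q <= 1 ->
  T1 n t <= n.+1%:R * (2 `^ (- q)) ^+ n.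
Proof.
move=> q1; apply: (@le_trans _ _ (v n t `^ q)).
  apply: (@iter_cos_transfer_le (fun n t => v n t `^ q)) => {n t} [t|n t].
    by rewrite /v expr0 !mul0r addr0 mul1r powR1.
  apply: (@le_trans _ _ (((`|cos (pi * (t / 2))| * v n (t / 2) +
    `|sin (pi * (t / 2))| * v n ((t + 1) / 2)) / 2) `^ q)).
    rewrite /cos_transfer -!powRM//.
    by apply: powR_midpoint_concave; rewrite ?q0 ?mulr_ge0.
  apply: ge0_ler_powR; [exact: ltW| | |exact: v_step]; rewrite nnegrE//.
  by rewrite divr_ge0// addr_ge0// mulr_ge0.
apply: (@le_trans _ _ ((n.+1%:R * 2^-1 ^+ n) `^ q)).
  by apply: ge0_ler_powR; rewrite ?nnegrE// ?mulr_ge0 ?exprn_ge0// ltW.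
rewrite powRM ?exprn_ge0//.
have -> : (2^-1 ^+ n) `^ q = (2 `^ (- q)) ^+ n.
  elim: n => [|n IH]; first by rewrite !expr0 powR1.
  by rewrite !exprS powRM ?exprn_ge0// IH -powR_inv1// -powRrM mulN1r.
(* What remains is (n+1)^q <= n+1. *)
rewrite ler_wpM2r ?exprn_ge0 ?powR_ge0//.
by rewrite -[leRHS]powRr1// ler_powR// ler1n.
Qed.

End CosTransfer.

(** * Return to the complex operator, and conclusion *)

Lemma iter_transfer_cosE (R : realType) (q : R) (q0 : 0 < q) n t :
  iter n (transfer 2 (cos_weight q0)) (circle_one R) t =
  toC (iter n (cos_transfer q) (fun=> 1) t).
Proof.
elim: n t => [//|n IH] t.
rewrite iterS transfer_cosE !big_ord_recl big_ord0 addr0 !IH /= addr0.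
have -> : pi * ((t + (bump 0 0)%:R) / 2) = pi * (t / 2) + pi / 2 :> R.
  by rewrite /bump/=; field.
rewrite cosDpihalf normrN /cos_transfer /toC.
by rewrite mulrC [RHS]rmorphM rmorphD !rmorphM fmorphV rmorph_nat.
Qed.

Theorem theorem4p2 (R : realType) (q : R) (q_gt0 : 0 < q) :
  let L := transfer 2 (cos_weight q_gt0) in
  let L1 (n : nat) := iter n L (circle_one R) in
  (circle_min (L1 n) `^ (n%:R^-1) @[n --> \oo] --> (2^-1 : R)) /\
  (circle_max (L1 n) `^ (n%:R^-1) @[n --> \oo] -->
     (if q <= 1 then 2 `^ (- q) else 2^-1 : R)).
Proof.
move=> L L1.
have L1E n t : L1 n t = toC (iter n (cos_transfer q) (fun=> 1) t).
  exact: iter_transfer_cosE.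
have L1r n t : L1 n t \is Num.real by exact: iter_transfer_one_real.
have L1le n t c : (L1 n t <= toC c) = (iter n (cos_transfer q) (fun=> 1) t <= c).
  by rewrite L1E lecR.
have L1ge n t c : (toC c <= L1 n t) = (c <= iter n (cos_transfer q) (fun=> 1) t).
  by rewrite L1E lecR.
have lower n : 3^-1 `^ q * 2^-1 ^+ n <= circle_min (L1 n).
  have [[t tE] _] := circle_minP (L1r n); rewrite -lecR -/(toC _) -[leRHS]tE L1ge.
  exact: iter_cos_transfer_lower.
have min_half n : circle_min (L1 n) <= 2^-1 ^+ n.
  have [_ /(_ 0)] := circle_minP (L1r n); rewrite L1ge.
  by rewrite iter_cos_transfer0.
have max_ge n t : iter n (cos_transfer q) (fun=> 1) t <= circle_max (L1 n).
  by have [_ /(_ t)] := circle_maxP (L1r n); rewrite L1le.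
have max_le n c : (forall t, iter n (cos_transfer q) (fun=> 1) t <= c) ->
    circle_max (L1 n) <= c.
  have [[t tE] _] := circle_maxP (L1r n) => h.
  by rewrite -lecR -/(toC _) -[leLHS]tE L1le.
split.
  apply: (@cvg_root_geometric _ _ (3^-1 `^ q)) => // n.
  rewrite lower (le_trans (min_half n))//.
  by rewrite ler_peMl ?exprn_ge0// ler1n.
have [q1|/ltW q1] := leP q 1;
  apply: (@cvg_root_geometric _ _ 1); rewrite ?powR_gt0// => n.
  (* For q <= 1 the maximum is bounded below by the value at 1/2. *)
  rewrite mul1r (le_trans (iter_cos_transfer_half_ge q_gt0 n))//=.
  by apply: max_le => t; exact: iter_cos_transfer_upper_le1.
(* For q >= 1 it is bounded below by the value at 0. *)
rewrite mul1r -{1}(iter_cos_transfer0 q_gt0 n) max_ge/=.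
by apply: max_le => t; exact: iter_cos_transfer_upper_ge1.
Qed.
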